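(* Let $K$ be a field of characteristic zero and let $n\ge1$, $d\ge0$ be integers. A basis for the $K$-vector space of balancings over $K$ on the complete nonsingular $d$-complex $\Delta^{ns}_{n,d}$ on $n$ vertices is given by all balanced complexes of the form $\prod_{j=1}^{d+1}\{\{a_j\},\{b_j\}\}$, one for each possible choice of integers $1\le a_1<a_2<\cdots<a_{d+1}\le n$ with $a_j\ge 2j$ for each $j$, where $1\le b_1<b_2<\cdots<b_{d+1}\le n$ are the $d+1$ smallest elements of $\{1,2,\ldots,n\}\smallsetminus\{a_1,a_2,\ldots,a_{d+1}\}$, with the product balancing induced by balancing each $\{\{a_j\},\{b_j\}\}$ with weights $w(\{a_j\})=1$, $w(\{b_j\})=-1$.
   Context: The complete nonsingular $d$-complex on $n$ vertices $\Delta^{ns}_{n,d}$ is the set of all nonsingular $d$-simplices on $\{1,\ldots,n\}$, i.e. all subsets of $\{1,\ldots,n\}$ of cardinality $d+1$. In general a $d$-simplex is a multiset of cardinality $d+1$ and a $d$-complex is a set of $d$-simplices. $m(i\in S)$ is the multiplicity of $i$ in a multiset $S$, and $m(T\subseteq S)=\prod_{i}\binom{m(i\in S)}{m(i\in T)}$ (zero if $T\not\subseteq S$). A balancing over $K$ on a $d$-complex $\Delta$ on $\{1,\ldots,n\}$ is a function $w:\Delta\to K$ (zero values allowed) such that $\sum_{S\subseteq\sigma\in\Delta}w(\sigma)\,m(S\subseteq\sigma)=0$ for every multiset $S$ on $\{1,\ldots,n\}$ with $0\le|S|\le d$. A balancing on a subcomplex of $\Delta^{ns}_{n,d}$ is regarded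 as a balancing of $\Delta^{ns}_{n,d}$ by extending it by zero. With $\uplus$ denoting multiset sum (multiplicities add), the product of a $d_1$-complex $\Delta_1$ and a $d_2$-complex $\Delta_2$ is the $(d_1+d_2+1)$-complex $\Delta_1\cdot\Delta_2=\{\sigma_1\uplus\sigma_2:\sigma_1\in\Delta_1,\sigma_2\in\Delta_2\}$. If $w_1,w_2$ are balancings on $\Delta_1,\Delta_2$, the product balancing is $w(\sigma)=\sum w_1(\sigma_1)w_2(\sigma_2)$, the sum over all pairs $(\sigma_1,\sigma_2)\in\Delta_1\times\Delta_2$ with $\sigma_1\uplus\sigma_2=\sigma$. Products of several factors are iterated products. *)

(* Defs.v *)
From HB Require Import structures.
From mathcomp Require Import all_boot all_order all_algebra.
From mathcomp Require Import finmap multiset.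

Set Implicit Arguments.
Unset Strict Implicit.
Unset Printing Implicit Defensive.

Import GRing.Theory.
Local Open Scope ring_scope.
Local Open Scope fset_scope.
Local Open Scope mset_scope.

(* The vertex i of {1, ..., n} is the ordinal of value i - 1 in 'I_n. *)
Notation simplex n := {mset 'I_n}.
Notation complex n := {fset {mset 'I_n}}.

Section Complexes.
Variable n : nat.

Definition sub_mult (T S : simplex n) : nat := (\prod_(i < n) 'C(S i, T i))%N.

Definition mset_of_set (A : {set 'I_n}) : simplex n := seq_mset (enum A).

Definition ns_complex (d : nat) : complex n :=
  [fset mset_of_set A | A : {set 'I_n} in [pred A : {set 'I_n} | #|A| == d.+1]].

Lemma ns_complexP (d : nat) (s : simplex n) :
  s \in ns_complex d <-> size s = d.+1 /\ (forall i, s i <= 1)%N.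
Proof.
split=> [/imfsetP[A /= /eqP cA ->] | [szs s_le1]].
  split=> [|i]; first by rewrite (perm_size (perm_eq_seq_mset _)) -cardE.
  by rewrite mset_seqE count_uniq_mem ?enum_uniq // leq_b1.
have us : uniq s by apply/count_mem_uniq => i; rewrite count_mem_mset -mset_gt0;
  case: (s i) (s_le1 i) => [|[]].
apply/imfsetP; exists [set i in (s : seq 'I_n)].
  by apply/eqP; rewrite -szs -(card_uniqP us); apply: eq_card => i; rewrite inE.
apply/msetP => i; rewrite mset_seqE count_uniq_mem ?enum_uniq // mem_enum inE.
by rewrite -count_mem_mset count_uniq_mem.
Qed.

Definition prod_complex (D1 D2 : complex n) : complex n :=
  [fset s1 `+` s2 | s1 in D1, s2 in D2].

End Complexes.

Section Balancings.
Variables (K : fieldType) (n : nat).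

Definition balance_sum (D : complex n) (S : simplex n) (w : {ffun D -> K^o}) : K^o :=
  \sum_(s : D | S `<=` val s) w s * (sub_mult S (val s))%:R.

Definition is_balancing (d : nat) (D : complex n) (w : {ffun D -> K^o}) : Prop :=
  forall S : simplex n, (size S <= d)%N -> balance_sum S w = 0.

Fact balance_sum_is_linear (D : complex n) (S : simplex n) :
  linear (@balance_sum D S).
Proof.
move=> c u v; rewrite /balance_sum scaler_sumr -big_split /=.
by apply: eq_bigr => s _; rewrite !ffunE mulrDl scalerAl.
Qed.

HB.instance Definition _ (D : complex n) (S : simplex n) :=
  GRing.isLinear.Build K {ffun D -> K^o} K^o _ (@balance_sum D S)
    (@balance_sum_is_linear D S).

(* Every multiset of cardinality k is seq_mset t for some k-tuple t; see
   balancing_spaceP. *)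
Definition balancing_space (d : nat) (D : complex n) : {vspace {ffun D -> K^o}} :=
  (\bigcap_(k < d.+1) \bigcap_(t : k.-tuple 'I_n)
     lker (linfun (@balance_sum D (seq_mset t))))%VS.

Lemma balancing_spaceP (d : nat) (D : complex n) (w : {ffun D -> K^o}) :
  w \in balancing_space d D <-> is_balancing d w.
Proof.
rewrite memvE; split=> [/subv_bigcapP wP S leSd | wP].
  have /subv_bigcapP/(_ (in_tuple S) isT) := wP (Ordinal (leSd : size S < d.+1)%N) isT.
  by rewrite -memvE memv_ker lfunE /= seq_mset_id => /eqP.
apply/subv_bigcapP => k _; apply/subv_bigcapP => t _.
rewrite -memvE memv_ker lfunE /=; apply/eqP/wP.
by rewrite (perm_size (perm_eq_seq_mset t)) size_tuple -ltnS.
Qed.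

Record wcomplex := WComplex {
  wsupp : complex n;
  wt : {ffun wsupp -> K^o}
}.

Definition wprod (X Y : wcomplex) : wcomplex :=
  @WComplex (prod_complex (wsupp X) (wsupp Y))
    [ffun s => \sum_(p : wsupp X * wsupp Y | val p.1 `+` val p.2 == val s)
                 wt X p.1 * wt Y p.2].

(* The empty product: the empty simplex alone, with weight 1. *)
Definition wone : wcomplex := @WComplex [fset mset0] [ffun=> 1].

Definition wpair (a b : 'I_n) : wcomplex :=
  @WComplex [fset [mset a]; [mset b]]
    [ffun s => if val s == [mset a] then 1 else -1].

Definition ext0 (D : complex n) (X : wcomplex) : {ffun D -> K^o} :=
  [ffun s => if insub (val s) is Some u then wt X u else 0].

End Balancings.

Section Admissible.
Variables (n d : nat).
Implicit Type a : d.+1.-tuple 'I_n.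

(* With vertices and positions starting from 1: a_1 < ... < a_(d+1) and
   a_j >= 2j. *)
Definition admissible a : bool :=
  sorted ltn (map val a) && [forall j : 'I_d.+1, (2 * j.+1 <= (tnth a j).+1)%N].

(* In increasing order, since enum 'I_n is. *)
Definition compl a : seq 'I_n := [seq i <- enum 'I_n | i \notin a].

(* The default value of nth is not used when a is admissible, by
   size_compl. *)
Definition bvert a (j : 'I_d.+1) : 'I_n := nth (tnth a j) (compl a) j.

Lemma size_compl a : admissible a -> (d.+1 <= size (compl a))%N.
Proof.
case/andP=> sa /forallP/(_ ord_max) /= le2.
have ua : uniq a.
  by rewrite -(map_inj_uniq val_inj); apply: sorted_uniq sa;
    [exact: ltn_trans | exact: ltnn].
have le2n : (2 * d.+1 <= n)%N := leq_trans le2 (ltn_ord _).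
have := cardC (mem a); rewrite card_ord (card_uniqP ua) size_tuple => cE.
have -> : size (compl a) = #|[predC a]|.
  by rewrite cardE /compl enumT -enumT [in RHS]/enum_mem size_filter;
     rewrite size_filter /= enumT.
by rewrite -(leq_add2l d.+1) cE addnn -mul2n.
Qed.

Definition pair_prod (K : fieldType) a : wcomplex K n :=
  \big[@wprod K n/@wone K n]_(j < d.+1) wpair K (tnth a j) (bvert a j).

End Admissible.

(* Main.v *)
Require Import Defs.
From HB Require Import structures.
From mathcomp Require Import all_boot all_order all_algebra.
From mathcomp Require Import finmap multiset.

Set Implicit Arguments.
Unset Strict Implicit.
Unset Printing Implicit Defensive.

Import GRing.Theory.
Local Open Scope ring_scope.
Local Open Scope mset_scope.
Local Open Scope fset_scope.

(** Evaluate balancings at the admissible tuples [a], ordered by the sum of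
    their entries (the rank). Everything follows from three facts.

    Products of pairs are balancings. A weight function is studied through its
    pairing with test functions [F] on multisets; multiplying by the pair
    [a - b] replaces [F] by the difference [t |-> F (a + t) - F (b + t)]
    ([pairing_cons]). The balancing condition for [S] is the test function
    [sub_mult S]. If [S] has at most [d] elements, it misses one of the [d + 1]
    disjoint pairs, whose difference operator therefore kills [sub_mult S];
    since difference operators commute, the whole pairing vanishes
    ([pair_prod_balancing]).

    The products are unitriangular. The ballot condition [a_j >= 2j] forces
    [b_j < a_j] ([bvert_lt]), so the product has coefficient 1 at
    [a_1, ..., a_(d+1)] and all its other terms have smaller rank
    ([pair_prod_lead]).

    A balancing [w] that vanishes at all admissible simplices is zero
    ([balancing_ballot0]). By inclusion-exclusion, [w] sums to zero over the
    simplices that contain [S] and avoid [T] whenever [#|S| + #|T| <= d]. If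
    [s] is not admissible, some element [v] of [s] has fewer non-elements than
    elements of [s] among [1, ..., v]; take for [S] the elements of [s] above
    [v] and for [T] the non-elements of [s] below [v]. Every other simplex in
    the resulting sum arises from [s] by moving elements from below [v] to
    above [v], and so has larger rank: [w] vanishes at [s] by induction
    downwards on the rank.

    A unitriangular family in a space on which the evaluations are jointly
    injective is a basis ([triangular_basis]). *)

(** * Unitriangular families of vectors and functionals *)

Section Triangular.
Variables (K : fieldType) (V : vectType K) (I : finType) (P : pred I).
Variables (v : I -> V) (e : I -> 'Hom(V, K^o)) (rk : I -> nat).
Hypothesis tri : forall i j, P i -> P j -> (rk j <= rk i)%N ->
  e i (v j) = (i == j)%:R.

(** In a vanishing combination, evaluate at an index of largest rank among
    those with a nonzero coefficient: only its own term survives. *)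
Lemma triangular_free : free [seq v i | i in P].
Proof.
have -> : [seq v i | i in P] = [tuple v (enum_val i) | i < #|P|].
  apply: (@eq_from_nth _ 0); rewrite size_image ?size_tuple // => i lti.
  by rewrite (nth_image _ _ (Ordinal lti)) (nth_mktuple _ _ (Ordinal lti)).
have Pe (i : 'I_#|P|) : P (enum_val i) := enum_valP i.
apply/freeP => c c0 i0.
have e0 (i : 'I_#|P|) : \sum_j c j * e (enum_val i) (v (enum_val j)) = 0 :> K.
  transitivity (e (enum_val i) 0); last by rewrite linear0.
  rewrite -c0 linear_sum; apply: eq_bigr => j _.
  by rewrite -tnth_nth tnth_mktuple linearZ.
apply/eqP/negPn/negP => ci0.
have [i ci maxi] := @arg_maxnP _ i0 (fun i => c i != 0)
  (fun i => rk (enum_val i)) ci0.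
have := e0 i; rewrite (bigD1 i) //= (tri (Pe i) (Pe i) (leqnn _)) eqxx mulr1.
rewrite big1 ?addr0; first by move/eqP; rewrite (negPf ci).
move=> j ji; have [->|cj] := eqVneq (c j) 0; first by rewrite mul0r.
rewrite (tri (Pe i) (Pe j) (maxi j cj)) (inj_eq enum_val_inj).
by rewrite eq_sym (negPf ji) mulr0.
Qed.

Variable U : {vspace V}.
Hypothesis vU : forall i, P i -> v i \in U.
Hypothesis sepU : forall w, w \in U -> (forall i, P i -> e i w = 0) -> w = 0.

(** The induction on [N] peels off the components of rank [N]: subtracting
    them kills the functionals of rank [N] without disturbing those of larger
    rank. *)
Lemma triangular_span N w : w \in U ->
  (forall i, P i -> (N <= rk i)%N -> e i w = 0) -> w \in <<[seq v i | i in P]>>%VS.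
Proof.
elim: N w => [|N IH] w wU ew0.
  by rewrite (sepU wU) ?mem0v // => i Pi; apply: ew0.
have vspan i : P i -> v i \in <<[seq v i | i in P]>>%VS.
  by move=> Pi; apply/memv_span/image_f.
set u := \sum_(i | P i && (rk i == N)) e i w *: v i.
rewrite -(subrK u w) rpredD ?rpred_sum //; last first.
  by move=> i /andP[Pi _]; rewrite memvZ ?vspan.
apply: IH => [|i Pi leNi].
  by rewrite rpredB ?rpred_sum // => i /andP[Pi _]; rewrite memvZ ?vU.
rewrite linearB linear_sum /=.
have eE j : P j && (rk j == N) -> e i (e j w *: v j) = e j w * (i == j)%:R.
  by case/andP=> Pj /eqP rj; rewrite linearZ /= tri ?rj.
rewrite (eq_bigr _ eE).
have [ri|ri] := eqVneq (rk i) N; last first.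
  have ltNi : (N < rk i)%N by rewrite ltn_neqAle eq_sym ri.
  rewrite ew0 // big1 ?subr0 // => j /andP[_ /eqP rj].
  by rewrite (negPf (_ : i != j)) ?mulr0 //; apply: contraNneq ri => ->; apply/eqP.
rewrite (bigD1 i) ?Pi ?ri ?eqxx //= mulr1 big1 ?addr0 ?subrr // => j.
by case/andP=> _; rewrite eq_sym => /negPf->; rewrite mulr0.
Qed.

Lemma triangular_basis : basis_of U [seq v i | i in P].
Proof.
rewrite /basis_of triangular_free andbT eqEsubv; apply/andP; split.
  by apply/span_subvP => _ /imageP[i Pi ->]; apply: vU.
apply/subvP => w /(@triangular_span (\max_i rk i).+1); apply=> i _.
by rewrite ltnNge leq_bigmax.
Qed.
End Triangular.

(** * Weighted complexes as functionals *)

Section Pairing.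
Variables (K : fieldType) (n : nat).
Implicit Types (D : complex n) (F : simplex n -> K) (X Y : wcomplex K n).

(** The test function [F] is defined on all multisets, so that one [F] can be
    paired with weights on any complex. Balancing conditions and coefficients
    are both of this form ([balance_sumE], [pairing_delta]). *)
Definition pairing D F (w : {ffun D -> K^o}) : K^o :=
  \sum_(s : D) w s * F (val s).

Fact pairing_is_linear D F : linear (@pairing D F).
Proof.
move=> c u v; rewrite /pairing scaler_sumr -big_split /=.
by apply: eq_bigr => s _; rewrite !ffunE mulrDl scalerAl.
Qed.

HB.instance Definition _ D F :=
  GRing.isLinear.Build K {ffun D -> K^o} K^o _ (@pairing D F)
    (@pairing_is_linear D F).

Lemma pairing0 D F (w : {ffun D -> K^o}) : (forall s, F s = 0) -> pairing F w = 0.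
Proof. by move=> F0; apply: big1 => s _; rewrite F0 mulr0. Qed.

Lemma sub_mult_nsub (S s : simplex n) : ~~ (S `<=` s)%mset -> sub_mult S s = 0%N.
Proof.
case/forallPn => x; rewrite -ltnNge => ltsS.
by rewrite /sub_mult (bigD1 (val x)) //= bin_small.
Qed.

Lemma balance_sumE D (S : simplex n) (w : {ffun D -> K^o}) :
  balance_sum S w = pairing (fun s => (sub_mult S s)%:R) w.
Proof.
rewrite /balance_sum big_mkcond; apply: eq_bigr => s _.
by case: ifPn => // /sub_mult_nsub->; rewrite mulr0.
Qed.

Lemma pairing_delta D (w : {ffun D -> K^o}) (s : D) :
  pairing (fun t => (t == val s)%:R) w = w s.
Proof.
rewrite /pairing (bigD1 s) //= eqxx mulr1 big1 ?addr0 // => t ts.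
by rewrite (inj_eq val_inj) (negPf ts) mulr0.
Qed.

Lemma pairing_ext0 D X F : wsupp X `<=` D ->
  pairing F (ext0 D X) = pairing F (wt X).
Proof.
move=> sXD; pose f s : K := if insub s is Some u then wt X u else 0.
transitivity (\sum_(s <- D) f s * F s).
  rewrite (big_seq_fsetE _ _ predT (fun s => f s * F s)).
  by apply: eq_bigr => s _; rewrite ffunE.
rewrite -(big_fset_incl _ sXD) => [|s _ sX]; last by rewrite /f insubN ?mul0r.
rewrite (big_seq_fsetE _ _ predT (fun s => f s * F s)).
by apply: eq_bigr => s _; rewrite /f valK.
Qed.

Lemma pairing_wone F : pairing F (wt (wone K n)) = F mset0.
Proof.
have x0 : mset0 \in [fset (mset0 : simplex n)] by apply: fset11.
rewrite /pairing (bigD1 [` x0]) //= ffunE mul1r big1 ?addr0 // => s /negP[].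
by rewrite -val_eqE /=; have := valP s; rewrite inE.
Qed.

Lemma pairing_wpair F (a b : 'I_n) : a != b ->
  pairing F (wt (wpair K a b)) = F [mset a] - F [mset b].
Proof.
move=> ab.
have Ea : [mset a] \in [fset [mset a]; [mset b]] by apply: fset21.
have Eb : [mset b] \in [fset [mset a]; [mset b]] by apply: fset22.
have ba : ([mset b] == [mset a] :> simplex n) = false.
  apply: contra_neqF ab => /eqP eqba.
  by apply/eqP; rewrite -in_mset1 eqba in_mset1.
rewrite /pairing (bigD1 [` Ea]) //= (bigD1 [` Eb]) /=; last first.
  by rewrite -val_eqE /= ba.
rewrite !ffunE /= eqxx ba mul1r mulN1r big1 ?addr0 // => s.
case/andP=> /negP sa /negP sb; case/fset2P: (valP s) => eqs.
  by case: sa; apply/eqP/val_inj.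
by case: sb; apply/eqP/val_inj.
Qed.

(** The pairing with a product complex is an iterated pairing, as for a
    convolution of measures. *)
Lemma pairing_wprod F X Y :
  pairing F (wt (wprod X Y)) =
  pairing (fun s => pairing (fun t => F (s `+` t)) (wt Y)) (wt X).
Proof.
rewrite /pairing /=; under eq_bigr do rewrite ffunE mulr_suml.
rewrite (exchange_big_dep predT) //=.
under [RHS]eq_bigr do rewrite mulr_sumr.
rewrite pair_big /=; apply: eq_bigr => -[s t] _ /=.
have st : (val s `+` val t) \in prod_complex (wsupp X) (wsupp Y).
  by rewrite in_imfset2 //=; apply: valP.
by rewrite (big_pred1 [` st]) /= ?mulrA // => u; rewrite /= eq_sym.
Qed.
End Pairing.

(** * Products of pairs *)

Section Rank.
Variable n : nat.
Implicit Types (s t : simplex n).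

Definition rank s : nat := (\sum_(i < n) i * s i)%N.

Lemma rankD s t : rank (s `+` t) = (rank s + rank t)%N.
Proof.
by rewrite /rank -big_split; apply: eq_bigr => i _; rewrite msetE2 mulnDr.
Qed.

Lemma rank1 i : rank [mset i] = i.
Proof.
rewrite /rank (bigD1 i) //= msetnxx muln1 big1 ?addn0 // => j /negPf ji.
by rewrite msetnE ji muln0.
Qed.

Lemma size_msetE s : size s = (\sum_(i < n) s i)%N.
Proof.
under eq_bigr => i _ do rewrite -count_mem_mset -sum1_count big_mkcond.
rewrite exchange_big -sum1_size; apply: eq_bigr => j _.
by rewrite (bigD1 j) //= eqxx big1 // => i; rewrite eq_sym => /negPf->.
Qed.

Lemma size_msetD s t : size (s `+` t) = (size s + size t)%N.
Proof. by rewrite !size_msetE -big_split; apply: eq_bigr => i _; rewrite msetE2. Qed.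

Lemma seq_mset_cons i (r : seq 'I_n) : seq_mset (i :: r) = i +` seq_mset r.
Proof. by apply/msetP => j; rewrite mset1DE !mset_seqE /= eq_sym. Qed.

End Rank.

Section PairProducts.
Variables (K : fieldType) (n : nat) (J : eqType) (a b : J -> 'I_n).
Implicit Types (r : seq J) (F : simplex n -> K) (s t : simplex n).

Definition prod_pairs r : wcomplex K n :=
  \big[@wprod K n/@wone K n]_(j <- r) wpair K (a j) (b j).

(** Multiplying by a pair is a difference operator on test functions; every
    property of the weights of a product of pairs follows from this by
    induction on the number of factors. *)
Lemma pairing_cons F j r : a j != b j ->
  pairing F (wt (prod_pairs (j :: r))) =
  pairing (fun t => F (a j +` t) - F (b j +` t)) (wt (prod_pairs r)).
Proof.
move=> ab; rewrite /prod_pairs big_cons pairing_wprod pairing_wpair //.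
by rewrite /pairing -sumrB; apply: eq_bigr => s _; rewrite mulrBr.
Qed.

(** Difference operators commute, so the one that kills [F] can be applied
    first. *)
Lemma pairing_prod_pairs0 F r j : {in r, forall i, a i != b i} -> j \in r ->
    (forall t, F (a j +` t) = F (b j +` t)) ->
  pairing F (wt (prod_pairs r)) = 0.
Proof.
elim: r F => // i r IH F ab jr Fj; rewrite pairing_cons ?ab ?mem_head //.
move: jr; rewrite inE => /predU1P[<-|jr].
  by apply: pairing0 => t; rewrite Fj subrr.
apply: IH => // [k kr|t]; first by rewrite ab // inE kr orbT.
rewrite (msetDCA [mset a i] [mset a j]) (msetDCA [mset b i] [mset a j]) 2!Fj.
by rewrite (msetDCA [mset b j] [mset a i]) (msetDCA [mset b j] [mset b i]).
Qed.

(** In the expanded product, every term other than the product of all the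
    [a j] has some [a j] replaced by the smaller [b j], hence smaller rank. *)
Lemma pairing_prod_pairs_lead F r : {in r, forall i, (b i < a i)%N} ->
    (forall t, (rank t < rank (seq_mset (map a r)))%N -> F t = 0) ->
  pairing F (wt (prod_pairs r)) = F (seq_mset (map a r)).
Proof.
elim: r F => [|j r IH] F ba F0.
  by rewrite /prod_pairs big_nil pairing_wone; congr F; apply/msetP => i;
     rewrite mset_seqE mset0E.
have baj : (b j < a j)%N by rewrite ba ?mem_head.
rewrite pairing_cons; last by rewrite -val_eqE neq_ltn baj orbT.
rewrite /= seq_mset_cons in F0 *.
rewrite IH => [|i ir|t ltt]; last 1 first.
- by rewrite !F0 ?subrr // !rankD !rank1 ?ltn_add2l // -addnS leq_add // ltnW.
- by rewrite [X in _ - X]F0 ?subr0 // !rankD !rank1 ltn_add2r.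
by rewrite ba // inE ir orbT.
Qed.

Lemma mem_prod_pairs r s : s \in wsupp (prod_pairs r) ->
  size s = size r /\ (forall i, s i <= count_mem i (map a r ++ map b r))%N.
Proof.
elim: r s => [|j r IH] s; rewrite /prod_pairs ?big_nil ?big_cons /=.
  by move/fset1P->; rewrite enum_mset0; split=> // i; rewrite mset0E.
case/imfset2P => u uab [t /IH[szt tle] ->].
have [c ->] : exists2 c, u = [mset c] & (c == a j) || (c == b j).
  by case/fset2P: uab => ->; [exists (a j) | exists (b j)]; rewrite ?eqxx ?orbT.
move=> cab; split=> [|i].
  by rewrite size_msetD szt enum_msetn.
rewrite mset1DE count_cat /= addnA addnACA -count_cat.
apply: leq_add => //.
by case/orP: cab => /eqP->; rewrite eq_sym ?leq_addr ?leq_addl.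
Qed.

End PairProducts.

(** * Balancings are determined by their values on ballot sets *)

Section OrdinalSets.
Variable n : nat.
Implicit Types (A B : {set 'I_n}).

Lemma card_ord_lt m : (m <= n)%N -> #|[set i : 'I_n | (i < m)%N]| = m.
Proof.
move=> lemn.
by rewrite -sum1dep_card -(big_ord_widen _ (fun=> 1%N)) // sum1_card card_ord.
Qed.

(** Each of the exchanged elements moves from at most [v] to above [v], which
    increases the sum by at least one. *)
Lemma sum_ord_shift A B (v : nat) : #|A| = #|B| ->
    {in A :\: B, forall i : 'I_n, (i <= v)%N} ->
    {in B :\: A, forall i : 'I_n, (v < i)%N} ->
  (\sum_(i in A) i + #|B :\: A| <= \sum_(i in B) i)%N.
Proof.
move=> cAB Av Bv.
have cD : #|A :\: B| = #|B :\: A|.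
  by apply/eqP; rewrite -(eqn_add2l #|A :&: B|) cardsID setIC cardsID cAB.
rewrite (big_setID B) [leqRHS](big_setID A) /= setIC -addnA leq_add2l.
have leA : (\sum_(i in A :\: B) i <= #|A :\: B| * v)%N.
  by rewrite -sum_nat_const; apply: leq_sum => i; apply: Av.
have leB : (#|B :\: A| * v.+1 <= \sum_(i in B :\: A) i)%N.
  by rewrite -sum_nat_const; apply: leq_sum => i; apply: Bv.
by rewrite (leq_trans _ leB) // mulnSr leq_add2r -cD.
Qed.

(** The reformulation of the ballot condition on a set [A] that does not
    number its elements: each element [v] of [A] has at least as many vertices
    outside [A] as inside [A] among those up to [v]. *)
Definition ballot A : bool :=
  [forall v in A, (2 * #|[set i in A | (i <= v)%N]| <= v.+1)%N].

End OrdinalSets.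

Section Vanishing.
Variables (K : fieldType) (n d : nat).
Local Notation D := (ns_complex n d).
Implicit Types (s t : D) (S T : {set 'I_n}).

Definition supp (s : simplex n) : {set 'I_n} := [set i in (s : seq 'I_n)].

Lemma mset_of_setE S i : mset_of_set S i = (i \in S).
Proof. by rewrite mset_seqE count_uniq_mem ?enum_uniq // mem_enum. Qed.

Lemma ns_mult s i : (val s : simplex n) i = (i \in supp (val s)).
Proof.
have [/ns_complexP[_ /(_ i)]] := valP s.
by rewrite inE in_mset; case: (_ i) => [|[]].
Qed.

Lemma ns_card s : #|supp (val s)| = d.+1.
Proof.
have [/ns_complexP[<- _]] := valP s.
rewrite size_msetE -sum1_card big_mkcond; apply: eq_bigr => i _.
by rewrite ns_mult; case: (_ \in _).
Qed.

Lemma ns_rank s : rank (val s) = (\sum_(i in supp (val s)) i)%N.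
Proof.
rewrite /rank [RHS]big_mkcond; apply: eq_bigr => i _.
by rewrite ns_mult; case: (_ \in _); rewrite ?muln1 ?muln0.
Qed.

Lemma ns_suppK s : mset_of_set (supp (val s)) = val s.
Proof. by apply/msetP => i; rewrite mset_of_setE ns_mult. Qed.

Lemma ns_supp_inj s t : supp (val s) = supp (val t) -> s = t.
Proof. by move=> eqst; apply/val_inj; rewrite -ns_suppK eqst ns_suppK. Qed.

Lemma sub_mult_ns S s : sub_mult (mset_of_set S) (val s) = (S \subset supp (val s)).
Proof.
have [/subsetP sSs|/subsetPn[i iS is_]] := boolP (S \subset _).
  apply: big1 => i _; rewrite mset_of_setE ns_mult.
  by case: (boolP (i \in S)) => [/sSs->|]; rewrite ?bin0.
by rewrite /sub_mult (bigD1 i) //= mset_of_setE ns_mult iS (negPf is_).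
Qed.

Variable w : {ffun D -> K^o}.
Hypothesis w_bal : is_balancing d w.

Lemma balancing_sup S : (#|S| <= d)%N ->
  \sum_(s : D | S \subset supp (val s)) w s = 0.
Proof.
move=> leSd; have := w_bal (S := mset_of_set S).
rewrite (perm_size (perm_eq_seq_mset _)) -cardE => /(_ leSd) bal0.
rewrite -[RHS]bal0 balance_sumE big_mkcond; apply: eq_bigr => s _.
by rewrite sub_mult_ns; case: (_ \subset _); rewrite ?mulr1 ?mulr0.
Qed.

(** Inclusion-exclusion over [T]: allowing a vertex [x] of [T] again adds the
    simplices that contain it, which are those containing [x |: S]. *)
Lemma balancing_sup_disjoint S T : (#|S| + #|T| <= d)%N ->
  \sum_(s : D | (S \subset supp (val s)) && (T \subset ~: supp (val s))) w s = 0.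
Proof.
elim: {T}_.+1 {-2}T (ltnSn #|T|) S => // m IH T ltTm S leSTd.
have [T0|[x xT]] := set_0Vmem T.
  rewrite -[RHS](@balancing_sup S) ?(leq_trans _ leSTd) ?leq_addr //.
  by apply: eq_bigl => s; rewrite T0 sub0set andbT.
have cT : #|T| = #|T :\ x|.+1 by rewrite (cardsD1 x) xT.
have disjT s : (T \subset ~: supp (val s)) =
    (T :\ x \subset ~: supp (val s)) && (x \notin supp (val s)).
  by rewrite -{1}(setD1K xT) subUset sub1set inE andbC.
have IHS : \sum_(s : D | (S \subset supp (val s)) &&
    (T :\ x \subset ~: supp (val s))) w s = 0.
  apply: IH; first by rewrite -ltnS -cT.
  by rewrite (leq_trans _ leSTd) // leq_add2l cT.
have IHxS : \sum_(s : D | (S \subset supp (val s)) &&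
    (T :\ x \subset ~: supp (val s)) && (x \in supp (val s))) w s = 0.
  rewrite -[RHS](IH (T :\ x) _ (x |: S)); first last.
  - rewrite (leq_trans _ leSTd) // cT addnS -addSn leq_add2r cardsU1.
    by case: (_ \in _).
  - by rewrite -ltnS -cT.
  by apply: eq_bigl => s; rewrite subUset sub1set andbC andbA.
rewrite -{}[RHS]IHS [RHS](bigID (fun s : D => x \in supp (val s))) /= IHxS add0r.
by apply: eq_bigl => s; rewrite disjT andbA.
Qed.

(** If [v] violates the ballot condition for [s], then the simplices that
    contain the vertices of [s] above [v] and avoid the non-vertices of [s] up
    to [v] have weights of sum zero, and among them [s] has the smallest
    rank. *)
Lemma balancing_ballot0 : (forall s, ballot (supp (val s)) -> w s = 0) -> w = 0.
Proof.
move=> w0; apply/ffunP => s; rewrite [RHS]ffunE.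
have rank_le t : (rank (val t) <= \sum_(i < n) i)%N.
  rewrite ns_rank [leqLHS]big_mkcond; apply: leq_sum => i _.
  by case: (_ \in _).
have [m] := ubnP (\sum_(i < n) i - rank (val s))%N.
elim: m s => // m IH s lesm.
have [/w0//|] := boolP (ballot (supp (val s))).
case/forall_inPn => v vs; rewrite -ltnNge => lt2v.
set A := supp (val s) in vs lt2v *.
pose L : {set 'I_n} := [set i : 'I_n | (i <= v)%N].
have cL : #|L| = v.+1 := card_ord_lt (ltn_ord v).
have cAL : #|A| = d.+1 := ns_card s.
have := @balancing_sup_disjoint (A :\: L) (L :\: A).
rewrite (bigD1 s) /= -/A; last first.
  by rewrite subsetDl setDE subsetIr.
rewrite big1 ?addr0 => [->//|t /andP[/andP[sAt dAt] nst]].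
  (* Since [L :&: A] outnumbers [L :\: A], the constraints on [A :\: L] and
     [L :\: A] together number fewer than [#|A|], which is [d.+1]. *)
  have cA := cardsID L A; have cL' := cardsID A L.
  move: lt2v; rewrite (_ : [set _ in A | _] = L :&: A); last first.
    by apply/setP => i; rewrite !inE andbC.
  rewrite -cL -cL' mul2n -addnn ltn_add2l => ltLA.
  by rewrite -ltnS -cAL -cA addnC ltn_add2r setIC.
apply: IH; suff ltst : (rank (val s) < rank (val t))%N.
  by rewrite -ltnS (leq_trans _ lesm) // ltnS ltn_sub2l // (leq_trans ltst).
set B := supp (val t) in sAt dAt *.
rewrite !ns_rank -/A -/B.
have cAB : #|A| = #|B| by rewrite !ns_card.
apply: leq_trans (sum_ord_shift (v := v) cAB _ _).
- rewrite -addn1 leq_add2l card_gt0 finset.setD_eq0; apply: contra nst => sBA.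
  by apply/eqP/esym/ns_supp_inj/eqP; rewrite eq_sym eqEcard sBA cAB leqnn.
- move=> i /setDP[iA iB]; rewrite leqNgt; apply: contra iB => ltvi.
  by apply: (subsetP sAt); rewrite in_setD iA inE -ltnNge ltvi.
- move=> i /setDP[iB iA]; rewrite ltnNge; apply: contraL iB => leiv.
  by rewrite -in_setC; apply: (subsetP dAt); rewrite in_setD iA inE leiv.
Qed.

End Vanishing.

(** * Admissible tuples and ballot sets *)

Section AdmissibleTuples.
Variables (n d : nat).
Implicit Types (a : d.+1.-tuple 'I_n).

Lemma ltn_nth_sorted_ord (s : seq 'I_n) x0 j k :
    sorted ltn (map val s) -> (j < size s)%N -> (k < size s)%N ->
  (nth x0 s j < nth x0 s k)%N = (j < k)%N.
Proof.
rewrite sorted_map => ss ltj ltk.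
have ltT : transitive (relpre val ltn : rel 'I_n) by move=> ? ? ?; apply: ltn_trans.
have nth_mono := sorted_ltn_nth ltT x0 ss.
apply/idP/idP => [|ltjk]; last exact: nth_mono.
rewrite !ltnNge; apply: contra; rewrite leq_eqVlt => /predU1P[->//|ltkj].
exact/ltnW/nth_mono.
Qed.

Lemma admissible_uniq a : admissible a -> uniq a.
Proof.
case/andP=> sa _; rewrite -(map_inj_uniq val_inj).
exact: (sorted_uniq ltn_trans ltnn).
Qed.

Lemma admissible_inj a1 a2 : admissible a1 -> admissible a2 ->
  seq_mset a1 = seq_mset a2 -> a1 = a2.
Proof.
move=> /andP[s1 _] /andP[s2 _] /eq_seq_msetP p12.
apply/val_inj/(inj_map val_inj).
apply: (irr_sorted_eq ltn_trans ltnn s1 s2) => i.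
by apply: perm_mem; apply: perm_map.
Qed.

Lemma sorted_filter_enum_ord (A : pred 'I_n) :
  sorted ltn (map val [seq i <- enum 'I_n | A i]).
Proof.
apply: (subseq_sorted ltn_trans (s2 := map val (enum 'I_n))).
  by rewrite map_subseq ?filter_subseq.
by rewrite val_enum_ord iota_ltn_sorted.
Qed.

Lemma mem_bvert a j : admissible a -> bvert a j \in compl a.
Proof.
by move=> aa; rewrite mem_nth // (leq_trans _ (size_compl aa)).
Qed.

(** Were [bvert a j] larger than [tnth a j], the vertices below [tnth a j]
    would be among the first [j] entries of [a] and the first [j] entries of
    [compl a], whereas there are more than [2 * j] of them. *)
Lemma bvert_lt a j : admissible a -> (bvert a j < tnth a j)%N.
Proof.
move=> aa; have [sa /forallP/(_ j) lt2j] := andP aa.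
have bc := mem_bvert j aa.
have sc : sorted ltn (map val (compl a)) := sorted_filter_enum_ord _.
have ltjc : (j < size (compl a))%N by rewrite (leq_trans _ (size_compl aa)).
have ltja : (j < size a)%N by rewrite size_tuple.
rewrite ltnNge; apply/negP => leab.
have mem_take_lt (s : seq 'I_n) i : sorted ltn (map val s) -> i \in s ->
    (j < size s)%N -> (i < nth (tnth a j) s j)%N -> i \in take j s.
  move=> ss is_ ltjs; rewrite in_take // -{1}(nth_index (tnth a j) is_).
  by rewrite ltn_nth_sorted_ord // index_mem.
have sub : [set i : 'I_n | (i < tnth a j)%N] \subset take j a ++ take j (compl a).
  apply/subsetP => i; rewrite inE mem_cat => lti.
  have [ia|ia] := boolP (i \in a).
    by rewrite mem_take_lt // -tnth_nth.
  rewrite [X in _ || X]mem_take_lt ?orbT //.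
    by rewrite mem_filter ia mem_enum.
  exact: leq_trans leab.
have := leq_trans (subset_leq_card sub) (card_size _).
rewrite (card_ord_lt (ltnW (ltn_ord _))) size_cat.
rewrite (size_takel (ltnW ltja)) (size_takel (ltnW ltjc)).
by rewrite leqNgt addnn -mul2n -ltnS -[(2 * j).+2]addn2 -mulnSr lt2j.
Qed.

Lemma admissible_pairs_uniq a : admissible a ->
  uniq (map (tnth a) (enum 'I_d.+1) ++ map (bvert a) (enum 'I_d.+1)).
Proof.
move=> aa; rewrite map_tnth_enum cat_uniq (admissible_uniq aa) /=.
apply/andP; split.
  apply/hasPn => _ /mapP[j _ ->]; have := mem_bvert j aa.
  by rewrite mem_filter => /andP[].
rewrite map_inj_uniq ?enum_uniq // => j k.
have ltc (i : 'I_d.+1) : (i < size (compl a))%N.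
  by rewrite (leq_trans _ (size_compl aa)).
rewrite /bvert (set_nth_default (tnth a k)) // => /eqP.
have uc : uniq (compl a) by apply/filter_uniq/enum_uniq.
by rewrite nth_uniq // => /eqP/val_inj.
Qed.

(** The first [j.+1] elements of [A] are elements of [A] up to the one of
    index [j], so the ballot condition there bounds that element from below. *)
Lemma ballot_admissible (A : {set 'I_n}) : #|A| = d.+1 -> ballot A ->
  exists2 a : d.+1.-tuple 'I_n, admissible a & seq_mset a = mset_of_set A.
Proof.
move=> cA /forall_inP bA.
have szA : size (enum A) == d.+1 by rewrite -cardE cA.
exists (Tuple szA) => //.
have sA : sorted ltn (map val (enum A)).
  rewrite (_ : enum A = [seq i <- enum 'I_n | i \in A]) ?sorted_filter_enum_ord //.
  by rewrite [enum 'I_n]enumT.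
apply/andP; split=> //; apply/forallP => j.
set v := tnth _ j; have vE : v = nth v (enum A) j by apply: tnth_nth.
have ltj : (j < size (enum A))%N by rewrite (eqP szA).
have vA : v \in A by rewrite -mem_enum; apply: mem_tnth.
apply: leq_trans (bA v vA); rewrite leq_mul2l /=.
have ut : uniq (take j.+1 (enum A)) by rewrite take_uniq ?enum_uniq.
rewrite -[leqLHS](size_takel (s := enum A)) // -(card_uniqP ut).
apply/subset_leq_card/subsetP => i it; rewrite inE -mem_enum (mem_take it) /=.
have ie := mem_take it; move: it; rewrite in_take // ltnS leqNgt.
rewrite -(ltn_nth_sorted_ord v sA) ?index_mem //.
by rewrite nth_index // -vE -leqNgt.
Qed.
End AdmissibleTuples.

(** * The basis of products of pairs *)

Section PairProd.
Variables (K : fieldType) (n d : nat).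
Implicit Types (a : d.+1.-tuple 'I_n).

Lemma pair_prodE a :
  pair_prod K a = prod_pairs K (tnth a) (bvert a) (enum 'I_d.+1).
Proof. by rewrite /pair_prod /prod_pairs [index_enum _]unlock enumT. Qed.

Lemma pair_prod_ns a : admissible a ->
  wsupp (pair_prod K a) `<=` ns_complex n d.
Proof.
move=> aa; apply/fsubsetP => s; rewrite pair_prodE => /mem_prod_pairs[szs les].
apply/ns_complexP; rewrite szs size_enum_ord; split=> // i.
by rewrite (leq_trans (les i)) // count_uniq_mem ?leq_b1 // admissible_pairs_uniq.
Qed.

Lemma sub_mult_add1 (S t : simplex n) i : S i = 0%N ->
  sub_mult S (i +` t) = sub_mult S t.
Proof.
move=> Si; apply: eq_bigr => j _; rewrite mset1DE.
by have [->|] := eqVneq j i; rewrite ?Si ?bin0.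
Qed.

(** A multiset of size at most [d] misses one of the [d.+1] disjoint
    pairs entirely, and the test function that counts its occurrences does not
    distinguish the two vertices of that pair. *)
Lemma pair_prod_balancing a : admissible a -> is_balancing d (wt (pair_prod K a)).
Proof.
move=> aa S leSd; rewrite balance_sumE pair_prodE.
have [j /andP[/eqP Sa /eqP Sb]] :
    exists j, (S (tnth a j) == 0%N) && (S (bvert a j) == 0%N).
  apply/existsP; apply: contraLR leSd; rewrite negb_exists -ltnNge => /forallP S_gt0.
  apply: (@leq_trans (\sum_(j <- enum 'I_d.+1) (S (tnth a j) + S (bvert a j)))%N).
    rewrite -[leqLHS](size_enum_ord d.+1) -sum1_size; apply: leq_sum => j _.
    by have := S_gt0 j; rewrite -addn_eq0 lt0n.
  have <- : (\sum_(i <- map (tnth a) (enum 'I_d.+1) ++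
      map (bvert a) (enum 'I_d.+1)) S i =
      \sum_(j <- enum 'I_d.+1) (S (tnth a j) + S (bvert a j)))%N.
    by rewrite big_cat !big_map big_split.
  rewrite big_uniq ?admissible_pairs_uniq // size_msetE [leqLHS]big_mkcond.
  by apply: leq_sum => i _; case: ifP.
apply: (pairing_prod_pairs0 (j := j)); rewrite ?mem_enum //.
  by move=> i _; rewrite -val_eqE neq_ltn /= bvert_lt // orbT.
by move=> t; rewrite !sub_mult_add1.
Qed.

Lemma pair_prod_lead a (F : simplex n -> K) : admissible a ->
    (forall t, (rank t < rank (seq_mset a))%N -> F t = 0) ->
  pairing F (wt (pair_prod K a)) = F (seq_mset a).
Proof.
move=> aa F0; rewrite pair_prodE pairing_prod_pairs_lead ?map_tnth_enum //.
by move=> j _; apply: bvert_lt.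
Qed.
End PairProd.

Theorem proposition5p7 (K : fieldType) (n d : nat)
    (charK : [pchar K] =i pred0) (n_gt0 : (0 < n)%N) :
  (forall a : d.+1.-tuple 'I_n, admissible a ->
     wsupp (pair_prod K a) `<=` ns_complex n d /\
     is_balancing d (wt (pair_prod K a))) /\
  basis_of (balancing_space K d (ns_complex n d))
    [seq ext0 (ns_complex n d) (pair_prod K a) |
       a in @admissible n d].
Proof.
split=> [a aa|]; first by split; [apply: pair_prod_ns|apply: pair_prod_balancing].
pose delta (a : d.+1.-tuple 'I_n) (t : simplex n) : K := (t == seq_mset a)%:R.
apply: (triangular_basis (e := fun a => linfun (pairing (delta a)))
  (rk := fun a => rank (seq_mset a))).
- move=> a1 a2 aa1 aa2 le21; rewrite lfunE /= pairing_ext0 ?pair_prod_ns //.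
  rewrite pair_prod_lead // => [|t ltt2].
    rewrite /delta; congr (_%:R); congr nat_of_bool.
    by apply/eqP/eqP => [/admissible_inj-> | ->].
  by rewrite /delta; case: eqP ltt2 => // ->; rewrite ltnNge le21.
- move=> a aa; apply/balancing_spaceP => S leSd.
  rewrite balance_sumE pairing_ext0 ?pair_prod_ns // -balance_sumE.
  exact: pair_prod_balancing.
- move=> w /balancing_spaceP w_bal w0; apply: balancing_ballot0 => // s bs.
  have [a aa aE] := ballot_admissible (ns_card s) bs.
  by have := w0 a aa; rewrite lfunE /= /delta aE ns_suppK pairing_delta.
Qed.
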